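(* Let $m$ be a positive integer, let $\Gamma\subseteq 2^{[m]}$, and suppose that $T\subseteq[m]$ is an independent subset of $\Gamma$, i.e. $\#(T\cap F)\le 1$ for all $F\in\Gamma$. Fix positive integers $r_s$ for $s\in[m]\setminus T$. Then $A_\Gamma$ has a finite Markov basis up to the natural action of $\mathfrak{S}_{r_1}\times\cdots\times\mathfrak{S}_{r_m}$ as $r_t\to\infty$ for all $t\in T$. That is: there exist positive integers $r_i$ for $i\in T$ (giving, with the fixed values, $r=(r_1,\dots,r_m)$) and a finite set $\mathcal{B}\subseteq\ker_{\mathbb{Z}}A_{\Gamma,r}$ such that for all $t\in\mathbb{N}^m$ with $t_i=0$ for $i\in[m]\setminus T$, the set $$(\mathfrak{S}_{r_1+t_1}\times\cdots\times\mathfrak{S}_{r_m+t_m})\cdot\{\mathrm{pad}_{r+t}(b):b\in\mathcal{B}\}$$ is a Markov basis for $A_{\Gamma,r+t}$.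
   Context: $[n]=\{1,\dots,n\}$ and $\mathbb{N}=\{0,1,2,\dots\}$. For $r=(r_1,\dots,r_m)$ with $r_i$ positive integers and $F\subseteq[m]$, let $R_F=\prod_{i\in F}[r_i]$ and $R=R_{[m]}$. For ${\bf i}\in R$ let ${\bf i}_F=(i_f)_{f\in F}\in R_F$. The $F$-marginal $u\mapsto u|_F$ from $\mathbb{R}^R$ to $\mathbb{R}^{R_F}$ is the linear map with $e_{\bf i}|_F=e_{{\bf i}_F}$, where $e_{\bf i}$, $e_{{\bf i}_F}$ are standard unit vectors (tables). For $\Gamma=\{F_1,F_2,\dots\}\subseteq 2^{[m]}$, the $\Gamma$-marginal map is $\pi_{\Gamma,r}:\mathbb{R}^R\to\bigoplus_{F\in\Gamma}\mathbb{R}^{R_F}$, $u\mapsto(u|_{F_1},u|_{F_2},\dots)$, and $A_{\Gamma,r}$ is the integer matrix representing it. $\ker_{\mathbb{Z}}A_{\Gamma,r}$ is the set of integer tables in $\mathbb{Z}^R$ in its kernel. A Markov basis for an integer matrix $A$ (with columns indexed by a finite set $M$) is a finite subset $\mathcal{B}\subset\ker_{\mathbb{Z}}A$ such that for all $u,v\in\mathbb{N}^M$ with $Au=Av$ there is a sequence $b_1,\dots,b_L\in\mathcal{B}$ with $u=v+\sum_{i=1}^Lb_i$ and $v+\sum_{i=1}^lb_i\in\mathbb{N}^M$ for $l=1,\dots,L$. Here a binomial $x^u - x^v$ and its negative encode the same move, so Markov bases are understood as sets of moves up to sign: each $b_i$ may be taken to be an element of $\mathcal{B}$ or the negative of one.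 The group $\mathfrak{S}_{r_1}\times\cdots\times\mathfrak{S}_{r_m}$ acts on tables in $\mathbb{Z}^R$ with $\mathfrak{S}_{r_i}$ permuting the values of the $i$th index. For $b\in\ker_{\mathbb{Z}}A_{\Gamma,r}$ and $t\in\mathbb{N}^m$, $\mathrm{pad}_{r+t}(b)\in\ker_{\mathbb{Z}}A_{\Gamma,r+t}$ is the table of size $(r_1+t_1)\times\cdots\times(r_m+t_m)$ obtained from $b$ by filling the new entries with zeroes. *)

(* Defs.v *)
From HB Require Import structures.
From mathcomp Require Import all_boot all_order all_fingroup all_algebra.
From mathcomp Require Import finmap.

Set Implicit Arguments.
Unset Strict Implicit.
Unset Printing Implicit Defensive.

Import Order.TTheory GRing.Theory Num.Theory.

Local Open Scope ring_scope.

(* Matrices with rows and columns indexed by arbitrary finite types, since the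
   'M[R]_(p, n) of the library only allows ordinals as indices. *)
Section IntegerMatrix.
Variables (N M : finType) (A : N -> M -> int).
Implicit Types (u v : {ffun M -> int}) (B : {fset {ffun M -> int}}).

Definition mulmxt u : {ffun N -> int} := [ffun k => \sum_(i : M) A k i * u i].

Definition kerZ u : Prop := mulmxt u = 0.

(* N^M, seen inside Z^M *)
Definition nonneg u : Prop := forall i, 0 <= u i.

(* The sequence bs is b_1, ..., b_L; each b_i is an element of B up to sign. *)
Definition markov_path B v u (bs : seq {ffun M -> int}) : Prop :=
  [/\ forall b, b \in bs -> b \in B \/ - b \in B,
      u = v + \sum_(b <- bs) b
    & forall l, (1 <= l <= size bs)%N -> nonneg (v + \sum_(b <- take l bs) b)].

Definition markov_basis B : Prop :=
  (forall b, b \in B -> kerZ b) /\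
  (forall u v, nonneg u -> nonneg v -> mulmxt u = mulmxt v ->
     exists bs, markov_path B v u bs).

End IntegerMatrix.

(* The index set [m] is 'I_m, and [r_i] is 'I_(r i). *)
Notation cell r := {dffun forall i, 'I_(r i)}.
Notation subcell r F := {dffun forall f : {f | f \in F}, 'I_(r (val f))}.
Notation table r := {ffun cell r -> int}.
Notation permfam r := {dffun forall i, 'S_(r i)}.

Section Marginals.
Variables (m : nat) (Gamma : {set {set 'I_m}}) (r : 'I_m -> nat).

Definition restr (F : {set 'I_m}) (i : cell r) : subcell r F :=
  [ffun f : {f | f \in F} => i (val f)].

Definition unit_table (I : finType) (i : I) : {ffun I -> int} :=
  [ffun j => (j == i)%:R].

Definition marginal (F : {set 'I_m}) (u : table r) : {ffun subcell r F -> int} :=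
  [ffun j => \sum_(i : cell r | restr F i == j) u i].

(* Coordinates of the direct sum of the Z^(R_F), for F in Gamma. *)
Definition marg_index : finType :=
  {F : {F : {set 'I_m} | F \in Gamma} & subcell r (val F)}.

Definition marg_map (u : table r) : {ffun marg_index -> int} :=
  [ffun k : marg_index => marginal (val (tag k)) u (tagged k)].

(* The columns of A_(Gamma, r) are the images of the unit tables. *)
Definition marg_mx (k : marg_index) (i : cell r) : int :=
  marg_map (unit_table i) k.

Lemma marginal_unit F i : marginal F (unit_table i) = unit_table (restr F i).
Proof.
apply/ffunP => j; rewrite !ffunE big_mkcond (bigD1 i) //= big1 => [|k /negPf ki].
  by rewrite addr0 ffunE eqxx eq_sym; case: eqP.
by rewrite ffunE ki; case: ifP.
Qed.

Lemma marg_mxP u : mulmxt marg_mx u = marg_map u.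
Proof.
apply/ffunP => k; rewrite !ffunE [RHS]big_mkcond /=.
apply: eq_bigr => i _; rewrite /marg_mx ffunE marginal_unit ffunE eq_sym.
by case: eqP; rewrite ?mul1r ?mul0r.
Qed.

End Marginals.

Definition perm_table m (r : 'I_m -> nat) (s : permfam r) (u : table r) :
    table r :=
  [ffun i : cell r => u [ffun k => (s k)^-1%g (i k)]].

Section Padding.
Variables (m : nat) (r t : 'I_m -> nat).

Definition widen_size (i : 'I_m) : nat := (r i + t i)%N.

Definition widen_cell (i : cell r) : cell widen_size :=
  [ffun k => lshift (t k) (i k)].

Definition pad (b : table r) : table widen_size :=
  [ffun j => if [pick i | widen_cell i == j] is Some i then b i else 0].

End Padding.

Definition pad_orbit m (r t : 'I_m -> nat) (B : {fset table r}) :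
    {fset table (widen_size r t)} :=
  [fset perm_table s (pad t b)
     | s in {: permfam (widen_size r t)}, b in B]%fset.

Definition independent m (Gamma : {set {set 'I_m}}) (T : {set 'I_m}) : Prop :=
  forall F, F \in Gamma -> (#|T :&: F| <= 1)%N.

(* Main.v *)
Require Import Defs.
From HB Require Import structures.
From mathcomp Require Import all_boot all_order all_fingroup all_algebra.
From mathcomp Require Import finmap zify.
From Stdlib Require Import Classical.

(** A nonnegative table is a finite multiset of cells, here a list of cells up
    to permutation, and two tables have the same image under the marginal map
    exactly when the lists of restrictions of their cells to each F in Gamma
    are permutations of each other.  Call F thin when it meets T in at most one
    index; independence of T says that every F in Gamma is thin.

    The theorem follows from a bound that does not depend on the sizes r_t,
    t in T ([degree_bound]): there is a D such that, whenever s and s' have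
    equal Gamma-marginals and are not both empty, there are a and a' with equal
    Gamma-marginals, not both empty and with at most D cells in all, such that
    every thin marginal of a is at most that of s, and likewise for a' and s'.

    The bound connects all fibers ([same_marg_connected]).  If two cells agree
    outside T, exchanging their t-th coordinates, t in T, is a move of degree 2
    which preserves all thin marginals.  Such swaps assemble inside s any cell
    whose thin restrictions all occur in s ([bring_to_front]), so they lead
    from s to a ++ w for some w ([extract_dominated]), and from s' to a' ++ w'.
    Replacing a by a' is a move of degree at most D, and w, w' are smaller than
    s, s' and have equal Gamma-marginals, so induction applies.

    For the bound, look at the signed list z consisting of s and s'.  The base
    of a cell is its restriction to the complement of T, which takes finitely
    many values.  For each t in T, every column of z (cells with a given t-th
    coordinate) is balanced over the sets F in Gamma containing t, a condition
    on bases alone; by Dickson's lemma it splits into balanced blocks of bounded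
    size ([cut_blocks]).  There are finitely many kinds of blocks, whatever r_t
    is, and a second use of Dickson's lemma, now on multisets of kinds of blocks,
    selects for every t a bounded number of blocks so that the selections for
    all t have the same list q of bases ([common_base]).  Since the bases match,
    the selected lists can be glued into a single signed list of cells which has
    the t-th coordinates of the selection for t ([glue]); its two sides are a
    and a'.

    Finally, moves of degree at most D between lists use at most 2D values of
    each index.  With r_t = 2D for t in T, a permutation of the values brings
    every such move inside the original box ([mem_pad_orbit]), so the finitely
    many moves of degree at most D in that box suffice. *)

Set Implicit Arguments.
Unset Strict Implicit.
Unset Printing Implicit Defensive.

Import Order.TTheory GRing.Theory Num.Theory.

Local Open Scope ring_scope.

(** * Lists up to permutation *)

Section Lists.

Lemma sum_count_mem (I : finType) (p : pred I) (s : seq I) :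
  (\sum_(i | p i) count_mem i s = count p s)%N.
Proof.
elim: s => [|x s IH] /=; first by rewrite big1.
rewrite big_split /= IH; congr (_ + _)%N.
rewrite big_mkcond (bigD1 x) //= big1 ?addn0 ?eqxx; first by case: (p x).
by move=> i /negPf; rewrite eq_sym => ->; case: ifP.
Qed.

Lemma seq_of_counts (I : finType) (f : I -> nat) :
  exists s : seq I, forall i, count_mem i s = f i.
Proof.
exists (\big[cat/[::]]_i nseq (f i) i) => i.
rewrite (big_morph (count_mem i) (count_cat _) (erefl : count_mem i [::] = 0%N)).
rewrite (bigD1 i) //= count_nseq /= eqxx mul1n big1 ?addn0 // => j /negPf ji.
by rewrite count_nseq /= ji.
Qed.

(** Lets a splitting of the image of a list be pulled back to the list itself. *)
Lemma perm_map_lift (X Y : eqType) (f : X -> Y) (z : seq X) (s : seq Y) :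
  perm_eq (map f z) s -> exists2 z', perm_eq z z' & map f z' = s.
Proof.
elim: s z => [|y s IH] z zs.
  by exists z => //; have := perm_size zs; rewrite size_map; case: (z).
have /mapP[x xz yE] : y \in map f z by rewrite (perm_mem zs) mem_head.
have zx := perm_to_rem xz.
have [|z' zz' z's] := IH (rem x z).
  by rewrite -(perm_cons y) {1}yE -map_cons -(permPl (perm_map f zx)).
by exists (x :: z'); rewrite /= ?z's -?yE // (permPl zx) perm_cons.
Qed.

Lemma perm_map_cat_lift (X Y : eqType) (f : X -> Y) z s0 s1 :
  perm_eq (map f z) (s0 ++ s1) ->
  exists z0 z1, [/\ perm_eq z (z0 ++ z1), map f z0 = s0 & map f z1 = s1].
Proof.
move=> /perm_map_lift[z' zz' z's]; exists (take (size s0) z'), (drop (size s0) z').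
by rewrite cat_take_drop map_take map_drop z's take_size_cat ?drop_size_cat.
Qed.

Lemma perm_map_coarser (X Y Z : eqType) (f : X -> Y) (g : X -> Z) s s' :
    {in s & s', forall x y, f x = f y -> g x = g y} ->
  perm_eq (map f s) (map f s') -> perm_eq (map g s) (map g s').
Proof.
elim: s s' => [|x s IH] s' fg ss'.
  by have := perm_size ss'; rewrite size_map; case: (s').
have /mapP[y ys' fxy] : f x \in map f s' by rewrite -(perm_mem ss') mem_head.
have s'y := perm_to_rem ys'.
rewrite (permPr (perm_map g s'y)) /= (fg x y) ?mem_head // perm_cons.
apply: IH => [a b sa /mem_rem s'b|]; first by apply: fg; rewrite // inE sa orbT.
by rewrite -(perm_cons (f x)) {2}fxy -!map_cons -(permPr (perm_map f s'y)).
Qed.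

Lemma perm_flatten_map (X Y : eqType) (g : X -> seq Y) s s' :
  perm_eq s s' -> perm_eq (flatten (map g s)) (flatten (map g s')).
Proof. by move=> ss'; apply/perm_flatten/perm_map. Qed.

End Lists.

(** * Dickson's lemma *)

Section Dickson.
Variable I : finType.

(** Dickson's lemma, in the form of a uniform bound on the minimal elements of P.
    Fix p in P.  An element of P that is not above p has some coordinate i whose
    value is one of the finitely many c < p i, so it lies in one of finitely many
    slices of P, each with one coordinate fewer that can vary.  The set J holds
    the coordinates that can still vary. *)
Lemma dickson_slice n (J : {set I}) (P : (I -> nat) -> Prop) :
    (#|J| < n)%N ->
    (forall f g, P f -> P g -> forall i, i \notin J -> f i = g i) ->
  exists D, forall f, P f ->
    exists g, [/\ P g, forall i, (g i <= f i)%N & forall i, (g i <= D)%N].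
Proof.
elim: n J P => // n IH J P Jn PJ.
have [[p Pp]|noP] := classic (exists p, P p); last first.
  by exists 0%N => f Pf; case: noP; exists f.
pose M := (\max_i p i)%N.
have /fin_all_exists[D_ D_P] (x : I * 'I_M) : exists D, x.1 \in J ->
    forall f, P f -> f x.1 = x.2 :> nat ->
    exists g, [/\ P g, forall i, (g i <= f i)%N & forall i, (g i <= D)%N].
  case: x => i c /=; have [iJ|] := boolP (i \in J); last by exists 0%N.
  have [||D DP] := IH (J :\ i) (fun f => P f /\ f i = c).
  - by rewrite -ltnS (leq_trans _ Jn) // [#|J|](cardsD1 i) iJ.
  - move=> f g [Pf fi] [Pg gi] j; rewrite !inE negb_and negbK.
    by case/orP=> [/eqP ->|/(PJ _ _ Pf Pg)//]; rewrite fi gi.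
  exists D => _ f Pf fi; have [//|g [[Pg gi] gf gD]] := DP f _.
  by exists g.
exists (maxn M (\max_x D_ x)) => f Pf.
have [/forallP pf|] := boolP [forall i, (p i <= f i)%N].
  by exists p; split=> // i; rewrite leq_max leq_bigmax.
rewrite negb_forall => /existsP[i]; rewrite -ltnNge => fp.
have iJ : i \in J by apply: contraLR fp => /(PJ _ _ Pf Pp) ->; rewrite ltnn.
have fM : (f i < M)%N by rewrite (leq_trans fp) ?leq_bigmax.
have [g [Pg gf gD]] := D_P (i, Ordinal fM) iJ f Pf erefl.
exists g; split=> // j; rewrite leq_max; apply/orP; right.
exact: leq_trans (gD j) (leq_bigmax _).
Qed.

(** Dickson's lemma for multisets, obtained by counting multiplicities. *)
Lemma dickson_seq (P : seq I -> Prop) :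
  exists D, forall s, P s ->
    exists s0 s1, [/\ P s0, (size s0 <= D)%N & perm_eq s (s0 ++ s1)].
Proof.
pose P' f := exists2 s, P s & forall i, count_mem i s = f i.
have [|f g _ _ i|D DP] := @dickson_slice #|I|.+1 setT P'.
- by rewrite cardsT.
- by rewrite inE.
exists (#|I| * D)%N => s Ps.
have [|g [[s0 Ps0 s0g] gs gD]] := DP (fun i => count_mem i s); first by exists s.
have [s1 s1E] := seq_of_counts (fun i => count_mem i s - count_mem i s0)%N.
exists s0, s1; split=> //.
  rewrite -(count_predT s0) -sum_count_mem -sum_nat_const.
  by apply: leq_sum => i _; rewrite s0g.
apply/allP => i _ /=; rewrite count_cat s1E subnKC // s0g; exact: gs.
Qed.

End Dickson.

(** * Signed lists *)

Section Signed.

(** A pair of lists is handled as one list of elements tagged with the list that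
    they come from, so that both can be cut, permuted and glued together. *)
Definition side (X : Type) (b : bool) (z : seq (bool * X)) : seq X :=
  [seq c.2 | c <- z & c.1 == b].

Definition on_snd (X Y : Type) (f : X -> Y) (c : bool * X) : bool * Y :=
  (c.1, f c.2).

Definition balanced (X : Type) (Y : eqType) (f : X -> Y) (z : seq (bool * X)) :=
  perm_eq (map f (side true z)) (map f (side false z)).

Lemma side_map (X Y : Type) b (f : X -> Y) z :
  side b (map (on_snd f) z) = map f (side b z).
Proof. by rewrite /side filter_map -!map_comp. Qed.

Lemma side_pair (X : Type) b b' (s : seq X) :
  side b (map (pair b') s) = if b' == b then s else [::].
Proof.
by rewrite /side filter_map -map_comp; elim: s => [|x s /=]; case: eqP => //= _ ->.
Qed.

Lemma side_cat (X : Type) b (z z' : seq (bool * X)) :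
  side b (z ++ z') = side b z ++ side b z'.
Proof. by rewrite /side filter_cat map_cat. Qed.

Lemma perm_side (X : eqType) b (z z' : seq (bool * X)) :
  perm_eq z z' -> perm_eq (side b z) (side b z').
Proof. by move=> zz'; apply/perm_map/perm_filter. Qed.

Lemma mem_side (X : eqType) b (z : seq (bool * X)) x :
  (x \in side b z) = ((b, x) \in z).
Proof.
apply/mapP/idP=> [[[b' y]]|xz]; last by exists (b, x); rewrite // mem_filter eqxx.
by rewrite mem_filter /= => /andP[/eqP -> yz ->].
Qed.

Lemma size_sides (X : Type) (z : seq (bool * X)) :
  (size (side true z) + size (side false z) = size z)%N.
Proof. by elim: z => //= -[[] x] z; rewrite /side /= ?addnS => <-. Qed.

Lemma balanced_perm (X Y : eqType) (f : X -> Y) z z' :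
  perm_eq z z' -> balanced f z = balanced f z'.
Proof.
move=> zz'; rewrite /balanced (permPl (perm_map f (perm_side true zz'))).
by rewrite (permPr (perm_map f (perm_side false zz'))).
Qed.

Lemma balanced_cat (X : Type) (Y : eqType) (f : X -> Y) z z' :
  balanced f z -> balanced f (z ++ z') = balanced f z'.
Proof.
move=> fz; rewrite /balanced !side_cat !map_cat.
by rewrite (permPl (perm_cat fz (perm_refl _))) perm_cat2l.
Qed.

Lemma balanced_flatten (X Y : eqType) (f : X -> Y) zs :
  {in zs, forall z, balanced f z} -> balanced f (flatten zs).
Proof.
elim: zs => //= z zs IH fzs; rewrite balanced_cat; last exact: fzs (mem_head _ _).
by apply: IH => z' z'zs; rewrite fzs // inE z'zs orbT.
Qed.

Lemma balanced_map (X X' : Type) (Y : eqType) (f : X' -> Y) (g : X -> X') z :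
  balanced f (map (on_snd g) z) = balanced (f \o g) z.
Proof. by rewrite /balanced !side_map -!map_comp. Qed.

(** Being balanced passes to any function of f; on z it is enough that g is
    one. *)
Lemma balanced_coarser (X Y Z : eqType) (f : X -> Y) (g : X -> Z) z :
    {in z &, forall x y, f x.2 = f y.2 -> g x.2 = g y.2} ->
  balanced f z -> balanced g z.
Proof.
move=> fg; apply: perm_map_coarser => x y; rewrite !mem_side => xz yz.
exact: (fg _ _ xz yz).
Qed.

Lemma balanced_filter (X Y : eqType) (f : X -> Y) (p : pred X) z :
    {in z &, forall x y, f x.2 = f y.2 -> p x.2 = p y.2} ->
  balanced f z -> balanced f [seq c <- z | p c.2].
Proof.
move=> fp; have sideF b : side b [seq c <- z | p c.2] = filter p (side b z).
  rewrite /side filter_map -!filter_predI; congr map.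
  by apply: eq_filter => c /=; rewrite andbC.
rewrite /balanced !sideF => /seq.permP fz; apply/allP => y _ /=; apply/eqP.
have cE b : count_mem y (map f (filter p (side b z))) =
    count [pred x | (f x == y) && p x] (side b z).
  by rewrite (count_map f) count_filter.
have [/hasP[c cz /andP[/eqP fc pc]]|nop] :=
    boolP (has (fun c => (f c.2 == y) && p c.2) z).
  rewrite !cE; have := fz (pred1 y); rewrite !(count_map f) => E.
  suff cE' b : count [pred x | (f x == y) && p x] (side b z) =
      count (preim f (pred1 y)) (side b z) by rewrite !cE'.
  apply: eq_in_count => x; rewrite mem_side => xz /=.
  by case: eqP => //= fx; rewrite (fp _ _ xz cz) ?fx ?fc.
suff c0 b : count [pred x | (f x == y) && p x] (side b z) = 0%N by rewrite !cE !c0.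
apply/eqP; rewrite -leqn0 leqNgt -has_count; apply: contra nop => /hasP[x].
by rewrite mem_side => xz fx; apply/hasP; exists (b, x).
Qed.

End Signed.

(** * Bases of cells *)

Section Cells.
Variables (m : nat) (T : {set 'I_m}) (K : nat).

Notation base := {ffun 'I_m -> 'I_K.+1}.

(** The restriction of a cell to the complement of T, encoded in a type that does
    not depend on the sizes r, since bounds that hold for all r are needed. *)
Definition base_of r (c : cell r) : base :=
  [ffun i => if i \in T then ord0 else inord (c i)].

Definition base_restr (F : {set 'I_m}) (x : base) : base :=
  [ffun i => if i \in F then x i else ord0].

Lemma restrP r (F : {set 'I_m}) (c d : cell r) :
  (forall i, i \in F -> c i = d i) <-> restr F c = restr F d.
Proof.
split=> [cd|/ffunP cd i iF]; last by have := cd (exist _ i iF); rewrite !ffunE.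
by apply/ffunP => i; rewrite !ffunE cd // (valP i).
Qed.

Lemma base_restrP r (F : {set 'I_m}) (c d : cell r) :
    (forall i, i \notin T -> (r i <= K.+1)%N) ->
  (forall i, i \in F -> i \notin T -> c i = d i) <->
  base_restr F (base_of c) = base_restr F (base_of d).
Proof.
move=> rK; split=> [cd|/ffunP cd i iF iT].
  by apply/ffunP => i; rewrite !ffunE; case: ifP => // iF; case: ifPn => // /cd ->.
have := cd i; rewrite !ffunE iF (negPf iT) => /(congr1 val) /=.
have lt (e : cell r) : (e i < K.+1)%N := leq_trans (ltn_ord _) (rK i iT).
by rewrite !inordK // => /val_inj.
Qed.

Lemma base_ofP r (c d : cell r) :
    (forall i, i \notin T -> (r i <= K.+1)%N) ->
  (forall i, i \notin T -> c i = d i) <-> base_of c = base_of d.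
Proof.
move=> rK; have restrT x : base_restr setT x = x :> base.
  by apply/ffunP => i; rewrite ffunE inE.
rewrite -[base_of c]restrT -[base_of d]restrT -base_restrP //.
by split=> cd i *; apply: cd; rewrite // inE.
Qed.

End Cells.

(** * Cutting and selecting blocks *)

Section DegreeBound.
Variables (m : nat) (Gamma : {set {set 'I_m}}) (T : {set 'I_m}) (K : nat).
Hypothesis indT : independent Gamma T.

Notation base := {ffun 'I_m -> 'I_K.+1}.

Lemma independentP F t i :
  F \in Gamma -> t \in T -> t \in F -> i \in F -> i != t -> i \notin T.
Proof.
move=> FG tT tF iF it; apply/negP => iT.
have /card_le1_eqP/(_ i t) it_eq := indT FG.
by rewrite it_eq ?eqxx // !inE ?iT ?tT in it.
Qed.

(** For i in T, the marginals over the sets F containing i see each column of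
    cells with a given i-th coordinate separately, and see only the bases of the
    cells in it. *)
Definition column_balanced i (q : seq (bool * base)) : Prop :=
  i \in T -> forall F, F \in Gamma -> i \in F -> balanced (base_restr F) q.

Definition fiber_balanced i r (z : seq (bool * cell r)) : Prop :=
  i \in T -> forall F, F \in Gamma -> i \in F -> balanced (restr F) z.

Notation bbase r := (on_snd (@base_of m T K r)).

(** Dickson's lemma gives D for the nonempty column-balanced lists of bases.  In
    a fiber-balanced list, take the column of the first cell: its list of bases
    contains a nonempty balanced part of size at most D.  Within one column,
    equal restrictions of bases to F are equal restrictions of cells to F,
    because F contains no index of T other than i; so that part is balanced as a
    list of cells and can be split off. *)
Lemma cut_blocks i : exists D, forall r,
    (forall j, j \notin T -> (r j <= K.+1)%N) ->
  forall z : seq (bool * cell r), fiber_balanced i z ->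
    exists zs : seq (seq (bool * cell r)), perm_eq z (flatten zs) /\
      {in zs, forall b, (size b <= D)%N /\ fiber_balanced i b}.
Proof.
have [D DP] := dickson_seq (fun q : seq (bool * base) =>
  q <> [::] /\ column_balanced i q).
exists D => r rK z; have [n] := ubnP (size z).
elim: n z => // n IH [|c z] zn zbal; first by exists [::].
pose p (d : cell r) := d i == c.2 i.
pose zi := [seq d <- c :: z | p d.2]; pose zo := [seq d <- c :: z | ~~ p d.2].
have zE : perm_eq (c :: z) (zi ++ zo) by rewrite perm_sym; apply/permEl/perm_filterC.
have zi_bal : fiber_balanced i zi.
  move=> iT F FG iF; apply: balanced_filter (zbal iT F FG iF) => d e _ _.
  by move/restrP/(_ i iF); rewrite /p => ->.
have [|s0 [s1 [[s0n s0bal] s0D /perm_map_cat_lift]]] := DP (map (bbase r) zi).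
  split=> [|iT F FG iF]; first by rewrite /zi /= {1}/p eqxx.
  rewrite balanced_map; apply: balanced_coarser (zi_bal iT F FG iF) => d e _ _.
  by move=> /restrP de; apply/base_restrP => // j jF _; apply: de.
case=> z0 [z1 [ziE z0s _]].
have z0_bal : fiber_balanced i z0.
  move=> iT F FG iF; have := s0bal iT F FG iF; rewrite -z0s balanced_map.
  apply: balanced_coarser => d e dz ez /base_restrP de.
  have inz x : x \in z0 -> x.2 i = c.2 i.
    move=> xz; have : x \in zi by rewrite (perm_mem ziE) mem_cat xz.
    by rewrite mem_filter => /andP[/eqP].
  apply/restrP => j jF; have [->|ji] := eqVneq j i; first by rewrite !inz.
  by apply: de => //; apply: independentP FG iT iF jF ji.
have zE' : perm_eq (c :: z) (z0 ++ (z1 ++ zo)).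
  by rewrite (permPl zE) catA perm_cat2r.
have [||zs [zsE zsP]] := IH (z1 ++ zo).
- have := perm_size zE'; rewrite size_cat => sE; rewrite -ltnS (leq_trans _ zn) // sE.
  by rewrite ltnS -{1}[size (z1 ++ zo)]add0n ltn_add2r -(size_map (bbase r)) z0s; case: (s0) s0n.
- move=> iT F FG iF; have := zbal iT F FG iF.
  by rewrite (balanced_perm _ zE') balanced_cat //; exact: z0_bal.
exists (z0 :: zs); split=> [|b]; first by rewrite (permPl zE') /= perm_cat2l.
rewrite inE => /predU1P[->|/zsP//]; split=> //.
by rewrite -(size_map (bbase r)) z0s.
Qed.

(** Summand of the content of the blocks with label i in a list of labelled
    blocks. *)
Definition block_part (X L : Type) (I : eqType) (f : L -> seq X) (i : I)
  (x : I * L) : seq X := if x.1 == i then f x.2 else [::].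

(** All indices i, including those outside T, contribute a cutting of z into
    blocks, and the contents of each cutting is z.  Replacing cells by their
    bases, this gives a multiset in a finite type of labelled blocks such that
    the content of every label is one list of bases, which is nonempty and
    balanced over the members of Gamma disjoint from T.  Dickson's lemma applied
    to this property selects a bounded number of blocks for which it persists.
    The selections for the indices outside T will supply the coordinates outside
    T of the glued cells. *)
Lemma common_base : (0 < m)%N -> exists D, forall r,
    (forall j, j \notin T -> (r j <= K.+1)%N) ->
  forall z : seq (bool * cell r), z <> [::] ->
    (forall F, F \in Gamma -> balanced (restr F) z) ->
  exists q : seq (bool * base), exists2 zz : 'I_m -> seq (bool * cell r),
    [/\ q <> [::], (size q <= D)%N &
        forall F, F \in Gamma -> [disjoint F & T] -> balanced (base_restr F) q]
    & forall i, [/\ map (bbase r) (zz i) = q, fiber_balanced i (zz i) &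
                    exists z', perm_eq z (zz i ++ z')].
Proof.
move=> m_gt0; have /fin_all_exists[D_ D_P] := cut_blocks.
pose D1 := (\max_i D_ i)%N.
pose bparts i (w : seq ('I_m * D1.-bseq (bool * base))) :=
  flatten (map (block_part (fun h : D1.-bseq _ => h : seq _) i) w).
have [D DP] := dickson_seq (fun w => exists2 q : seq (bool * base),
  q <> [::] /\ forall F, F \in Gamma -> [disjoint F & T] -> balanced (base_restr F) q
  & forall i, perm_eq (bparts i w) q).
exists (D * D1)%N => r rK z z_n zbal.
have zfbal i : fiber_balanced i z by move=> _ F FG _; apply: zbal.
have /fin_all_exists[zs zsP] := fun i => D_P i r rK z (zfbal i).
pose cparts i (w : seq ('I_m * seq (bool * cell r))) := flatten (map (block_part id i) w).
have cparts_cat i w w' : cparts i (w ++ w') = cparts i w ++ cparts i w'.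
  by rewrite /cparts map_cat flatten_cat.
(* w is the list of all blocks of the cuttings, each with its index. *)
have [w [wz wP]] : exists w, (forall i, perm_eq (cparts i w) z) /\
    {in w, forall x, (size x.2 <= D1)%N /\ fiber_balanced x.1 x.2}.
  exists (flatten [seq [seq (i, b) | b <- zs i] | i <- enum 'I_m]); split=> [i|x].
    have cparts_label j b : cparts i [seq (j, x) | x <- b] =
        if j == i then flatten b else [::].
      rewrite /cparts -map_comp; case: ifP => ji.
        congr flatten; rewrite -[RHS]map_id; apply: eq_map => x /=.
        by rewrite /block_part /= ji.
      by elim: b => //= x b ->; rewrite /block_part /= ji.
    suff E ts : uniq ts -> cparts i (flatten [seq [seq (j, b) | b <- zs j] | j <- ts]) =
        if i \in ts then flatten (zs i) else [::].
      by rewrite E ?enum_uniq // mem_enum perm_sym (zsP i).1.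
    elim: ts => //= j ts IH /andP[jts /IH{}IH]; rewrite cparts_cat cparts_label IH inE.
    by have [->|_] //= := eqVneq i j; rewrite (negPf jts) cats0.
  case/flattenP => s /mapP[i _ ->] /mapP[b bzs ->] /=.
  have [bD bbal] := (zsP i).2 b bzs; split=> //.
  exact: leq_trans bD (leq_bigmax _).
pose code (x : 'I_m * seq (bool * cell r)) : 'I_m * D1.-bseq (bool * base) :=
  (x.1, insub_bseq D1 (map (bbase r) x.2)).
have codeE i w' : {subset w' <= w} -> bparts i (map code w') = map (bbase r) (cparts i w').
  move=> w'w; rewrite /bparts /cparts map_flatten -!map_comp; congr flatten.
  apply/eq_in_map => -[j b] /w'w /wP[bD _]; rewrite /= /block_part /=.
  by case: eqP => // _; rewrite insubdK // unfold_in size_map.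
have wz' i : perm_eq (bparts i (map code w)) (map (bbase r) z).
  by rewrite codeE //; apply/perm_map/wz.
have [|w0 [w1 [[q [q_n q_bal] w0q] w0D /perm_map_cat_lift]]] := DP (map code w).
  exists (map (bbase r) z) => //; split=> [|F FG FT]; first by case: (z) z_n.
  rewrite balanced_map; apply: balanced_coarser (zbal F FG) => d e _ _.
  by move=> /restrP de; apply/base_restrP => // j jF _; apply: de.
case=> v0 [v1 [wE v0w0 _]].
have v0w : {subset v0 <= w} by move=> x xv; rewrite (perm_mem wE) mem_cat xv.
have /fin_all_exists[zz zzP] i :
    exists z', perm_eq (cparts i v0) z' /\ map (bbase r) z' = q.
  have := w0q i; rewrite -v0w0 codeE // => /perm_map_lift[z' ? ?]; by exists z'.
exists q; exists zz; split=> //.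
(* The common content q is bounded through the content of any one label. *)
- have i0 := Ordinal m_gt0; rewrite -(perm_size (w0q i0)).
  rewrite (leq_trans _ (leq_mul w0D (leqnn D1))) // /bparts.
  elim: (w0) => //= x w' IH; rewrite size_cat mulSn leq_add //.
  by rewrite /block_part; case: ifP => // _; apply: size_bseq.
- exact: (zzP i).2.
- move=> iT F FG iF; rewrite -(balanced_perm _ (zzP i).1); apply: balanced_flatten => b.
  case/mapP => x xv ->; rewrite /block_part; case: eqP => [xi|_ //].
  by have [_] := wP x (v0w x xv); rewrite xi; apply.
exists (cparts i v1); rewrite -(permPl (wz i)).
by rewrite (permPl (perm_flatten_map _ wE)) -/(cparts _ _) cparts_cat perm_cat2r (zzP i).1.
Qed.

End DegreeBound.

(** * Marginals of lists of cells *)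

Section Marginals.
Variables (m : nat) (r : 'I_m -> nat).
Implicit Types (Delta : {set {set 'I_m}}) (s : seq (cell r)).

Definition same_marg Delta s s' : Prop :=
  forall F, F \in Delta -> perm_eq (map (restr F) s) (map (restr F) s').

Definition dominated Delta s s' : Prop :=
  forall F, F \in Delta ->
    exists rest, perm_eq (map (restr F) s') (map (restr F) s ++ rest).

Lemma same_marg_perm Delta s s' : perm_eq s s' -> same_marg Delta s s'.
Proof. by move=> ss' F _; apply: perm_map. Qed.

Lemma same_marg_sym Delta s s' : same_marg Delta s s' -> same_marg Delta s' s.
Proof. by move=> ss' F FD; rewrite perm_sym; apply: ss'. Qed.

Lemma same_marg_trans Delta s2 s1 s3 :
  same_marg Delta s1 s2 -> same_marg Delta s2 s3 -> same_marg Delta s1 s3.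
Proof. by move=> s12 s23 F FD; apply: perm_trans (s12 F FD) (s23 F FD). Qed.

Lemma same_marg_sub Delta Delta' s s' :
  {subset Delta' <= Delta} -> same_marg Delta s s' -> same_marg Delta' s s'.
Proof. by move=> DD' ss' F /DD'; apply: ss'. Qed.

Lemma same_marg_cat Delta s1 s1' s2 s2' :
  same_marg Delta s1 s1' -> same_marg Delta s2 s2' ->
  same_marg Delta (s1 ++ s2) (s1' ++ s2').
Proof. by move=> s1P s2P F FD; rewrite !map_cat perm_cat ?s1P ?s2P. Qed.

Lemma same_marg_cancel Delta s1 s1' s2 s2' :
  same_marg Delta s1 s1' -> same_marg Delta (s1 ++ s2) (s1' ++ s2') ->
  same_marg Delta s2 s2'.
Proof.
move=> s1P s12P F FD; rewrite -(perm_cat2l (map (restr F) s1)) -map_cat.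
by rewrite (permPl (s12P F FD)) map_cat perm_cat2r perm_sym s1P.
Qed.

End Marginals.

(** * Gluing and the degree bound *)

Section Glue.
Variables (m : nat) (Gamma : {set {set 'I_m}}) (T : {set 'I_m}) (K : nat).
Hypotheses (m_gt0 : (0 < m)%N) (indT : independent Gamma T).

Notation base := {ffun 'I_m -> 'I_K.+1}.
Notation bbase r := (on_snd (@base_of m T K r)).

Definition thin : {set {set 'I_m}} := [set F | (#|T :&: F| <= 1)%N].

Lemma thinP (F : {set 'I_m}) :
  F \in thin -> exists i, forall j, j \in F -> j != i -> j \notin T.
Proof.
rewrite inE => /card_le1_eqP FT; have [FT0|[i]] := set_0Vmem (T :&: F).
  exists (Ordinal m_gt0) => j jF _; apply/negP => jT.
  by have := in_set0 j; rewrite -FT0 inE jT jF.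
rewrite inE => /andP[iT iF]; exists i => j jF ji; apply/negP => jT.
by rewrite (FT j i) ?eqxx ?inE ?iT ?jT // in ji.
Qed.

Lemma Gamma_thin : {subset Gamma <= thin}.
Proof. by move=> F /indT FT; rewrite inE. Qed.

Variables (r : 'I_m -> nat) (rK : forall j, j \notin T -> (r j <= K.+1)%N).

(** Lists with the same bases, one for each index, are glued entry by entry: the
    k-th cell takes its i-th coordinate from the k-th cell of the i-th list.
    Outside T all these cells agree, so on a set F whose only index in T is i
    the result cannot be told apart from the i-th list. *)
Lemma glue (q : seq (bool * base)) (zz : 'I_m -> seq (bool * cell r)) :
    (forall i, map (bbase r) (zz i) = q) ->
  exists2 a : seq (bool * cell r), map (bbase r) a = q
    & forall i (F : {set _}), (forall j, j \in F -> j != i -> j \notin T) ->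
      map (on_snd (restr F)) a = map (on_snd (restr F)) (zz i).
Proof.
elim: q zz => [|x q IH] zz zzq.
  by exists [::] => // i F _; case: (zz i) (zzq i).
have [|a aq aP] := IH (fun i => behead (zz i)).
  by move=> i; case: (zz i) (zzq i) => //= ? ? [].
have [d _] : exists d : bool * cell r, True.
  by case: (zz (Ordinal m_gt0)) (zzq (Ordinal m_gt0)) => // d; exists d.
pose c i := head d (zz i).
have zzE i : zz i = c i :: behead (zz i) by rewrite /c; case: (zz i) (zzq i).
have cx i : bbase r (c i) = x by have := zzq i; rewrite zzE => -[].
have cc i j k : k \notin T -> (c i).2 k = (c j).2 k.
  by move: k; apply/(base_ofP _ _ rK); case: (cx i) (cx j) => <- [].
pose e : cell r := [ffun i => (c i).2 i].
have eP i (F : {set _}) : (forall j, j \in F -> j != i -> j \notin T) ->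
    restr F e = restr F (c i).2.
  move=> FP; apply/restrP => j jF; rewrite ffunE.
  by have [->//|/(FP j jF)/cc] := eqVneq j i; apply.
exists ((x.1, e) :: a) => [|i F FP] /=.
  rewrite aq; congr (_ :: _); rewrite -(cx (Ordinal m_gt0)) /on_snd /=; congr (_, _).
  by apply/(base_ofP _ _ rK) => i iT; rewrite ffunE; apply: cc.
rewrite (aP i) // [zz i in RHS]zzE /=; congr (_ :: _).
by rewrite /on_snd /= (eP i F FP) -(cx i).
Qed.

End Glue.

(** Balance of the glued list over F in Gamma is inherited from the selection for
    the index of F in T if there is one, and from the common list of bases
    otherwise. *)
Lemma degree_bound m (Gamma : {set {set 'I_m}}) (T : {set 'I_m}) K :
    (0 < m)%N -> independent Gamma T ->
  exists D, forall r, (forall j, j \notin T -> (r j <= K.+1)%N) ->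
  forall s s' : seq (cell r), same_marg Gamma s s' -> (0 < size s + size s')%N ->
  exists a a', [/\ same_marg Gamma a a', (0 < size a + size a' <= D)%N,
                   dominated (thin T) a s & dominated (thin T) a' s'].
Proof.
move=> m_gt0 indT; have [D DP] := common_base K indT m_gt0.
exists D => r rK s s' ss' s_gt0.
pose z := map (pair true) s ++ map (pair false) s'.
have zs : side true z = s.
  by rewrite side_cat !side_pair /= cats0.
have zs' : side false z = s' by rewrite side_cat !side_pair.
have [||q [zz [q_n qD qbal] zzP]] := DP r rK z.
- by move=> z0; move: s_gt0; rewrite -zs -zs' z0.
- by move=> F FG; rewrite /balanced zs zs' ss'.
have [|a aq aP] := glue m_gt0 rK (zz := zz) (q := q); first by move=> i; have [] := zzP i.
have sE b i (F : {set _}) : (forall j, j \in F -> j != i -> j \notin T) ->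
    map (restr F) (side b a) = map (restr F) (side b (zz i)).
  by move=> FP; rewrite -!side_map (aP i).
exists (side true a), (side false a); split.
- move=> F FG; rewrite -/(balanced _ a).
  have [FT0|[t]] := set_0Vmem (T :&: F).
    have := qbal F FG; rewrite disjoint_sym -setI_eq0 FT0 eqxx => /(_ isT).
    rewrite -aq balanced_map; apply: balanced_coarser => d e _ _ /(base_restrP _ _ _ rK) de.
    apply/restrP => j jF; apply: de => //; apply/negP => jT.
    by have := in_set0 j; rewrite -FT0 inE jT jF.
  rewrite inE => /andP[tT tF]; have [_ zt _] := zzP t.
  have offT j : j \in F -> j != t -> j \notin T.
    by move=> jF jt; apply: (independentP indT FG tT tF jF jt).
  by rewrite /balanced !(sE _ t) //; apply: zt.
- rewrite size_sides -(size_map (on_snd (@base_of m T K r))) aq qD andbT.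
  by case: (q) q_n.
- move=> F /(thinP m_gt0)[i FP]; rewrite (sE _ i F FP) -zs; have [_ _ [z' zE]] := zzP i.
  exists (map (restr F) (side true z')).
  by rewrite -map_cat -side_cat; apply/perm_map/perm_side.
move=> F /(thinP m_gt0)[i FP]; rewrite (sE _ i F FP) -zs'; have [_ _ [z' zE]] := zzP i.
exists (map (restr F) (side false z')).
by rewrite -map_cat -side_cat; apply/perm_map/perm_side.
Qed.

(** * Connecting lists with equal marginals *)

Section Connect.
Variables (m : nat) (Gamma : {set {set 'I_m}}) (T : {set 'I_m}) (r : 'I_m -> nat).
Variable D : nat.
Hypotheses (m_gt0 : (0 < m)%N) (indT : independent Gamma T) (D_gt1 : (1 < D)%N).
Implicit Types (s a w : seq (cell r)).

(** A move takes a part a of the multiset s and puts a' in its place.  As every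
    list stands for a nonnegative table, a chain of such moves never has to be
    checked for nonnegativity. *)
Definition move_step s s' : Prop := exists a a' w,
  [/\ perm_eq s (a ++ w), perm_eq s' (a' ++ w), same_marg Gamma a a'
    & (size a <= D)%N /\ (size a' <= D)%N].

Inductive connected s : seq (cell r) -> Prop :=
| connected_refl : connected s s
| connected_step s1 s2 : move_step s s1 -> connected s1 s2 -> connected s s2.

Lemma connected_trans s2 s1 s3 : connected s1 s2 -> connected s2 s3 -> connected s1 s3.
Proof. by elim=> // s s4 s5 ss4 _ IH /IH; apply: connected_step. Qed.

Lemma connected1 s s' : move_step s s' -> connected s s'.
Proof. by move=> ss'; apply: connected_step ss' (connected_refl _). Qed.

Lemma connected_perm s s' : perm_eq s s' -> connected s s'.
Proof.
by move=> ss'; apply: connected1; exists [::], [::], s'; split=> //; apply: same_marg_perm.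
Qed.

Lemma connected_sym s s' : connected s s' -> connected s' s.
Proof.
elim=> [?|s1 s2 s3 [a [a' [w [sa sa' aa' [aD a'D]]]]] _ IH]; first exact: connected_refl.
apply: connected_trans IH (connected1 _); exists a', a, w; split=> //.
exact: same_marg_sym.
Qed.

Lemma connected_catl w s s' : connected s s' -> connected (w ++ s) (w ++ s').
Proof.
elim=> [?|s1 s2 s3 [a [a' [v [sa sa' aa' aD]]]] _ IH]; first exact: connected_refl.
apply: connected_step IH; exists a, a', (w ++ v); split=> //.
  by rewrite perm_sym perm_catCA perm_cat2l perm_sym.
by rewrite perm_sym perm_catCA perm_cat2l perm_sym.
Qed.

(** If a thin F contains t, its other indices lie outside T, where d and e agree;
    so the swap exchanges the restrictions to F.  If F does not contain t, it
    leaves them unchanged. *)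
Lemma swap_coord t (d e : cell r) : t \in T ->
    (forall i, i \notin T -> d i = e i) ->
  exists d' e' : cell r, [/\ d' t = e t, forall i, i != t -> d' i = d i
    & same_marg (thin T) [:: d; e] [:: d'; e']].
Proof.
move=> tT de.
pose d' : cell r := [ffun i => if i == t then e i else d i].
pose e' : cell r := [ffun i => if i == t then d i else e i].
exists d', e'; split=> [|i /negPf it|F]; rewrite ?ffunE ?eqxx ?it //.
rewrite inE => /card_le1_eqP FT; have [tF|tF] := boolP (t \in F).
  have offT i : i \in F -> i != t -> i \notin T.
    move=> iF it; apply/negP => iT.
    by rewrite (FT i t) ?eqxx ?inE ?iT ?tT // in it.
  have -> : map (restr F) [:: d'; e'] = map (restr F) [:: e; d].
    congr [:: _; _]; apply/restrP => i iF; rewrite ffunE; case: eqP => // /eqP it.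
      by apply: de; apply: offT.
    by rewrite de //; apply: offT.
  by apply/perm_map/(permEl (perm_catC [:: d] [:: e])).
suff -> : map (restr F) [:: d'; e'] = map (restr F) [:: d; e] by [].
congr [:: _; _]; apply/restrP => i iF; rewrite ffunE; case: eqP => // it;
  by rewrite -it iF in tF.
Qed.

(** Thin marginals are recorded because they, unlike the Gamma-marginals, determine
    the size of a list and what can be extracted from it. *)
Definition swapped s s' : Prop := connected s s' /\ same_marg (thin T) s s'.

Lemma swapped_perm s s' : perm_eq s s' -> swapped s s'.
Proof. by move=> ss'; split; [apply: connected_perm | apply: same_marg_perm]. Qed.

Lemma swapped_trans s2 s1 s3 : swapped s1 s2 -> swapped s2 s3 -> swapped s1 s3.
Proof.
by move=> [? ?] [? ?]; split; [apply: connected_trans|apply: same_marg_trans]; eauto.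
Qed.

(** Start from a cell of s which agrees with c outside T and correct its
    coordinates in T one at a time.  For the coordinate t, the restriction of c
    to t together with the complement of T still occurs in the list, because
    swaps keep thin marginals; the cell where it occurs is the one to swap
    with. *)
Lemma bring_to_front (c : cell r) s :
    (forall F, F \in thin T -> restr F c \in map (restr F) s) ->
  exists w, swapped s (c :: w).
Proof.
move=> cs.
suff [d [w [sw dc dT]]] : exists d w, [/\ swapped s (d :: w),
    forall i, i \notin T -> d i = c i & forall i, i \in enum T -> d i = c i].
  exists w; suff <- : d = c by [].
  apply/ffunP => i; have [iT|] := boolP (i \in T); last exact: dc.
  by apply: dT; rewrite mem_enum.
have : {subset enum T <= T} by move=> i; rewrite mem_enum.
elim: (enum T) => [_|t ts IH tsT].
  have /mapP[d ds /restrP dc] : restr (~: T) c \in map (restr (~: T)) s.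
    by apply: cs; rewrite inE setICr cards0.
  exists d, (rem d s); split=> //; first exact/swapped_perm/perm_to_rem.
  by move=> i iT; rewrite dc // inE.
have tT : t \in T by apply: tsT; rewrite mem_head.
have [|d [w [sw dc dts]]] := IH; first by move=> i its; apply: tsT; rewrite inE its orbT.
have tthin : t |: ~: T \in thin T.
  by rewrite inE setIUr setICr setU0 (leq_trans (subset_leq_card (subsetIr _ _))) ?cards1.
have /mapP[e] : restr (t |: ~: T) c \in map (restr (t |: ~: T)) (d :: w).
  by rewrite -(perm_mem (sw.2 _ tthin)); apply: cs.
move=> edw /restrP ec; have et : c t = e t by apply: ec; rewrite !inE eqxx.
have eT i : i \notin T -> c i = e i by move=> iT; apply: ec; rewrite !inE iT orbT.
move: edw; rewrite inE => /predU1P[ed|ew].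
  exists d, w; split=> // i; rewrite inE => /predU1P[->|/dts//].
  by rewrite et ed.
have [|d' [e' [d't d'd dd']]] := @swap_coord t d e tT; first by move=> i iT; rewrite dc ?eT.
have swE : perm_eq (d :: w) ([:: d; e] ++ rem e w).
  by rewrite /= perm_cons; apply: perm_to_rem.
exists d', (e' :: rem e w); split.
- apply: swapped_trans sw _; apply: swapped_trans (swapped_perm swE) _.
  split; last exact: (same_marg_cat dd' (same_marg_perm (perm_refl (rem e w)))).
  apply: connected1; exists [:: d; e], [:: d'; e'], (rem e w); split=> //.
  exact: same_marg_sub (Gamma_thin indT) dd'.
- move=> i iT; rewrite d'd ?dc //; by apply: contraNneq iT => ->.
move=> i; have [->|it] := eqVneq i t; first by rewrite d't et.
by rewrite inE (negPf it) d'd // => /dts.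
Qed.

Lemma extract_dominated a s : dominated (thin T) a s -> exists w, swapped s (a ++ w).
Proof.
elim: a s => [|c a IH] s sP; first by exists s; apply: swapped_perm.
have [|w sw] := @bring_to_front c s.
  by move=> F /sP[rest sE]; rewrite (perm_mem sE) mem_head.
have [|w' ww'] := IH w.
  move=> F FT; have [rest sE] := sP F FT; exists rest.
  rewrite -(perm_cons (restr F c)) -map_cons -(permPl (sw.2 F FT)).
  by rewrite (permPl sE).
exists w'; apply: swapped_trans sw _; split; first exact: (connected_catl [:: c] ww'.1).
exact: (same_marg_cat (same_marg_perm (perm_refl [:: c])) ww'.2).
Qed.

(** The marginal over the empty set counts the cells. *)
Lemma swapped_size s s' : swapped s s' -> size s = size s'.
Proof.
case=> _ /(_ set0); rewrite inE setI0 cards0 => /(_ isT)/perm_size.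
by rewrite !size_map.
Qed.

(** Induction on the number of cells.  Swaps bring small parts a and a' with equal
    Gamma-marginals to the front of s and s'; exchanging them is one move, and the
    remaining parts have equal Gamma-marginals by cancellation. *)
Lemma same_marg_connected :
    (forall s s', same_marg Gamma s s' -> (0 < size s + size s')%N ->
      exists a a', [/\ same_marg Gamma a a', (0 < size a + size a' <= D)%N,
                   dominated (thin T) a s & dominated (thin T) a' s']) ->
  forall s s', same_marg Gamma s s' -> connected s s'.
Proof.
move=> bound s s'; have [n] := ubnP (size s + size s').
elim: n s s' => // n IH s s' ltn ss'.
have [|ss'_gt0] := posnP (size s + size s').
  by case: s s' {ltn ss'} => [|//] [|//] _; apply: connected_refl.
have [a [a' [aa' /andP[a_gt0 aD] sa sa']]] := bound s s' ss' ss'_gt0.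
have [w sw] := extract_dominated sa; have [w' sw'] := extract_dominated sa'.
apply: connected_trans sw.1 _.
apply: (@connected_trans (a' ++ w)); last apply: connected_trans (connected_sym sw'.1).
  by apply: connected1; exists a, a', w; split=> //; lia.
apply/connected_catl/IH.
  by move: (swapped_size sw) (swapped_size sw'); rewrite !size_cat; lia.
apply: same_marg_cancel aa' _.
have swG := same_marg_sub (Gamma_thin indT).
apply: same_marg_trans (same_marg_sym (swG _ _ _ sw.2)) _.
exact: same_marg_trans ss' (swG _ _ _ sw'.2).
Qed.

End Connect.

(** * From lists to tables *)

Section Tables.
Variable C : finType.

Definition table_of (s : seq C) : {ffun C -> int} := [ffun c => (count_mem c s)%:Z].

Lemma table_of_cat s s' : table_of (s ++ s') = table_of s + table_of s'.
Proof. by apply/ffunP => c; rewrite !ffunE count_cat PoszD. Qed.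

Lemma table_of_perm s s' : perm_eq s s' -> table_of s = table_of s'.
Proof. by move=> /seq.permP ss'; apply/ffunP => c; rewrite !ffunE ss'. Qed.

Lemma table_of_nonneg s : nonneg (table_of s).
Proof. by move=> c; rewrite ffunE. Qed.

Lemma nonneg_table_of u : nonneg u -> exists s, u = table_of s.
Proof.
move=> u0; have [s sE] := seq_of_counts (fun c => `|u c|%N).
by exists s; apply/ffunP => c; rewrite ffunE sE gez0_abs.
Qed.

End Tables.

Section TableMarginals.
Variables (m : nat) (Gamma : {set {set 'I_m}}).

Lemma marginal_table_of r (F : {set 'I_m}) (s : seq (cell r)) :
  marginal F (table_of s) = table_of (map (restr F) s).
Proof.
apply/ffunP => j; rewrite !ffunE count_map -sum_count_mem (big_morph Posz PoszD (erefl _)).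
by apply: eq_bigr => i _; rewrite ffunE.
Qed.

Lemma eq_finfunP (I : finType) (Y : Type) (f g : I -> Y) :
  [ffun i => f i] = [ffun i => g i] <-> f =1 g.
Proof.
split=> [/ffunP fg i|fg]; first by have := fg i; rewrite !ffunE.
by apply/ffunP => i; rewrite !ffunE.
Qed.

Lemma marg_map_eqP (r : 'I_m -> nat) (u v : table r) :
  marg_map Gamma u = marg_map Gamma v <->
  forall F, F \in Gamma -> marginal F u = marginal F v.
Proof.
apply: iff_trans (eq_finfunP _ _) _; split=> [uv F FG|uv k].
  by apply/ffunP => j; exact: (uv (existT _ (exist _ F FG) j)).
by have E := uv _ (valP (tag k)); rewrite E.
Qed.

Lemma mulmxt_table_ofP r (s s' : seq (cell r)) :
  mulmxt (marg_mx (Gamma := Gamma) (r := r)) (table_of s) =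
  mulmxt (marg_mx (Gamma := Gamma) (r := r)) (table_of s') <-> same_marg Gamma s s'.
Proof.
rewrite !marg_mxP marg_map_eqP; split=> ss' F FG; last first.
  by rewrite !marginal_table_of; apply/table_of_perm/ss'.
apply/allP => y _ /=; apply/eqP; have := ss' F FG; rewrite !marginal_table_of.
by move=> /ffunP/(_ y); rewrite !ffunE => -[].
Qed.

Lemma mulmxtB (N M : finType) (A : N -> M -> int) u v :
  mulmxt A (u - v) = mulmxt A u - mulmxt A v.
Proof.
apply/ffunP => k; rewrite !ffunE -sumrB; apply: eq_bigr => i _.
by rewrite !ffunE mulrBr.
Qed.

Lemma kerZ_table_ofP r (s s' : seq (cell r)) :
  kerZ (marg_mx (Gamma := Gamma) (r := r)) (table_of s - table_of s') <-> same_marg Gamma s s'.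
Proof.
by rewrite -mulmxt_table_ofP /kerZ mulmxtB; split=> [/subr0_eq|->]; rewrite ?subrr.
Qed.

Definition cellmap (r r' : 'I_m -> nat) (phi : forall i, 'I_(r i) -> 'I_(r' i))
  (c : cell r) : cell r' := [ffun i => phi i (c i)].

Lemma same_marg_cellmap r r' (phi : forall i, 'I_(r i) -> 'I_(r' i)) s s' :
  same_marg Gamma s s' ->
  same_marg Gamma (map (cellmap phi) s) (map (cellmap phi) s').
Proof.
move=> ss' F FG; rewrite -!map_comp; apply: perm_map_coarser (ss' F FG) => c d _ _.
by move=> /restrP cd; apply/restrP => i iF; rewrite !ffunE cd.
Qed.

(** Padding and permuting values only relabel the cells, so the orbit of a move
    given by two lists consists of the moves given by relabelled lists. *)
Lemma perm_table_pad_table_of r t (sg : permfam (widen_size r t)) (s s' : seq (cell r)) :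
  let phi i x := sg i (lshift (t i) x) in
  perm_table sg (pad t (table_of s - table_of s')) =
  table_of (map (cellmap phi) s) - table_of (map (cellmap phi) s').
Proof.
move=> phi; apply/ffunP => j; rewrite !ffunE !count_map.
pose j' : cell (widen_size r t) := [ffun k => (sg k)^-1%g (j k)].
have phiE i : (cellmap phi i == j) = (widen_cell t i == j').
  apply/eqP/eqP => /ffunP ij; apply/ffunP => k; have := ij k; rewrite !ffunE /phi.
    by move=> <-; rewrite permK.
  by move=> ->; rewrite permKV.
case: pickP => [i /eqP ij|noi]; last first.
  have c0 u : count (preim (cellmap phi) (pred1 j)) u = 0%N.
    by rewrite -(count_pred0 u); apply: eq_count => i /=; rewrite phiE noi.
  by rewrite !c0.
rewrite !ffunE; suff cE u : count (preim (cellmap phi) (pred1 j)) u = count_mem i u by rewrite !cE.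
apply: eq_count => d /=; rewrite phiE; have <- : widen_cell t i = j' by [].
apply/eqP/eqP => [di|->//].
by apply/ffunP => k; have /ffunP/(_ k) := di; rewrite !ffunE => /lshift_inj.
Qed.

(** Listing X before its complement gives a permutation of the values under
    which X is covered by the first n of them. *)
Lemma perm_covering n k (X : {set 'I_(n + k)}) : (#|X| <= n)%N ->
  exists sg : 'S_(n + k), forall x, x \in X -> exists y, x = sg (lshift k y).
Proof.
move=> Xn; pose e := enum X ++ enum (~: X).
have se : size e == (n + k)%N by rewrite size_cat -!cardE cardsC card_ord.
have ue : uniq e.
  rewrite cat_uniq !enum_uniq andbT /=; apply/hasPn => x; rewrite !mem_enum inE.
  by [].
have inj : injective (tnth (Tuple se)) by apply/tuple_uniqP.
exists (perm inj) => x xX.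
have xe : (index x e < n)%N.
  rewrite (leq_trans _ Xn) // cardE index_cat mem_enum xX index_mem mem_enum //.
exists (Ordinal xe); rewrite permE (tnth_nth x) /= nth_index //.
by rewrite mem_cat mem_enum xX.
Qed.

(** Few cells use few values of each index, so some relabelling of the values
    puts all of them in the original box; where t i = 0 the box is already
    full. *)
Lemma cells_from_small r t (L : seq (cell (widen_size r t))) :
    (forall i, 0 < r i)%N -> (forall i, (size L <= r i)%N \/ t i = 0%N) ->
  exists (sg : permfam (widen_size r t)) (psi : forall i, 'I_(widen_size r t i) -> 'I_(r i)),
    {in L, forall c, cellmap (fun i x => sg i (lshift (t i) x)) (cellmap psi c) = c}.
Proof.
move=> r_gt0 small.
have /fin_all_exists[sg_ /fin_all_exists[psi psiP]] i :
    exists (sg : 'S_(widen_size r t i)) (psi : 'I_(widen_size r t i) -> 'I_(r i)),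
    {in L, forall c : cell (widen_size r t), sg (lshift (t i) (psi (c i))) = c i}.
  pose X := [set x in [seq c i | c : cell (widen_size r t) <- L]].
  have [|sg sgP] := @perm_covering (r i) (t i) X.
    have [Lr|ti0] := small i.
      by rewrite cardsE (leq_trans (card_size _)) // size_map.
    by rewrite (leq_trans (max_card _)) // card_ord /widen_size ti0 addn0.
  exists sg, (fun x => odflt (Ordinal (r_gt0 i)) [pick y | x == sg (lshift (t i) y)]).
  move=> c cL; case: pickP => [y /eqP <- //|noy].
  have [|y yE] := sgP (c i); first by rewrite inE; apply/mapP; exists c.
  by have := noy y; rewrite yE eqxx.
exists [ffun i => sg_ i], psi => c cL; apply/ffunP => i.
by rewrite !ffunE psiP.
Qed.

End TableMarginals.

(** * The Markov basis of moves of bounded degree *)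

Section MarkovBasis.
Variables (m : nat) (Gamma : {set {set 'I_m}}) (r : 'I_m -> nat) (D : nat).

Definition small_moves : {fset table r} :=
  [fset table_of p.1 - table_of p.2 | p : D.-bseq (cell r) * D.-bseq (cell r) in
     [pred p : D.-bseq (cell r) * D.-bseq (cell r) |
       [forall F in Gamma, perm_eq (map (restr F) p.1) (map (restr F) p.2)]]]%fset.

Lemma small_movesP b :
  reflect (exists s s', [/\ same_marg Gamma s s', (size s <= D)%N, (size s' <= D)%N
                          & b = table_of s - table_of s'])
          (b \in small_moves).
Proof.
apply: (iffP (imfsetP _ _ _ _)) => [[[s s'] /= ss' ->]|[s [s' [ss' sD s'D ->]]]].
  exists s, s'; split; rewrite ?size_bseq // => F FG.
  by move: ss' => /forall_inP/(_ F FG).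
exists (Bseq sD, Bseq s'D) => //=.
by apply/forall_inP => F; apply: ss'.
Qed.

Lemma pad_orbit_kerZ t b : b \in pad_orbit t small_moves ->
  kerZ (marg_mx (Gamma := Gamma) (r := widen_size r t)) b.
Proof.
case/imfset2P => sg _ [_ /small_movesP[s [s' [ss' _ _ ->]]] ->].
by rewrite perm_table_pad_table_of; apply/kerZ_table_ofP/same_marg_cellmap.
Qed.

Lemma mem_pad_orbit t (s s' : seq (cell (widen_size r t))) :
    (forall i, 0 < r i)%N -> (forall i, (D + D <= r i)%N \/ t i = 0%N) ->
    same_marg Gamma s s' -> (size s <= D)%N -> (size s' <= D)%N ->
  table_of s - table_of s' \in pad_orbit t small_moves.
Proof.
move=> r_gt0 rD ss' sD s'D.
have [|sg [psi psiP]] := @cells_from_small m r t (s ++ s') r_gt0.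
  move=> i; case: (rD i) => [ri|]; [left | by right].
  by rewrite size_cat (leq_trans _ ri) // leq_add.
apply/imfset2P; exists sg => //.
exists (table_of (map (cellmap psi) s) - table_of (map (cellmap psi) s')).
  apply/small_movesP; exists (map (cellmap psi) s), (map (cellmap psi) s').
  by split; rewrite ?size_map //; apply: same_marg_cellmap.
rewrite perm_table_pad_table_of -!map_comp.
by congr (table_of _ - table_of _); rewrite -[LHS]map_id; apply/eq_in_map => c cs;
  rewrite /= psiP // mem_cat cs ?orbT.
Qed.

Lemma connected_markov_path t (s s' : seq (cell (widen_size r t))) :
    (forall i, 0 < r i)%N -> (forall i, (D + D <= r i)%N \/ t i = 0%N) ->
    connected Gamma D s s' ->
  exists bs, markov_path (pad_orbit t small_moves) (table_of s) (table_of s') bs.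
Proof.
move=> r_gt0 rD; elim=> [u|u v w [a [a' [c [uE vE aa' [aD a'D]]]]] _ [bs [bsB bsE bsP]]].
  by exists [::]; split=> [b||[|l]] //; rewrite big_nil addr0.
have vuE : table_of v = table_of u + (table_of a' - table_of a).
  rewrite (table_of_perm uE) (table_of_perm vE) !table_of_cat.
  by rewrite [table_of a + _ + _]addrC addrA subrK.
exists ((table_of a' - table_of a) :: bs); split=> [b||l].
- rewrite inE => /predU1P[->|/bsB//]; left.
  by apply: mem_pad_orbit => //; apply: same_marg_sym.
- by rewrite big_cons addrA -vuE.
case: l => // l lbs; rewrite /= big_cons addrA -vuE.
case: l lbs => [_|l lbs]; last exact: bsP.
by rewrite take0 big_nil addr0; apply: table_of_nonneg.
Qed.

End MarkovBasis.

Theorem theorem4p7 (m : nat) (Gamma : {set {set 'I_m}}) (T : {set 'I_m})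
    (r0 : 'I_m -> nat) (hm : (0 < m)%N) (hT : independent Gamma T)
    (hr0 : forall s : 'I_m, s \notin T -> (0 < r0 s)%N) :
  exists r : 'I_m -> nat,
    [/\ forall i, (0 < r i)%N,
        forall s, s \notin T -> r s = r0 s
      & exists B : {fset table r},
          (forall b, b \in B -> kerZ (marg_mx (Gamma := Gamma) (r := r)) b) /\
          (forall t : 'I_m -> nat, (forall i, i \notin T -> t i = 0%N) ->
             markov_basis (marg_mx (Gamma := Gamma) (r := widen_size r t))
               (pad_orbit t B))].
Proof.
have [D0 D0P] := degree_bound (\max_i r0 i)%N hm hT.
(* Degree 2 is needed for the swaps; two lists of at most D cells use at most
   D + D values of an index. *)
pose D := maxn D0 2; pose r i := if i \in T then (D + D)%N else r0 i.
have r_gt0 i : (0 < r i)%N.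
  by rewrite /r; case: ifPn => [_|/hr0//]; rewrite addn_gt0 leq_max orbT.
exists r; split=> // [s /negPf sT|]; first by rewrite /r sT.
exists (small_moves Gamma r D); split=> [b /small_movesP[s [s' [ss' _ _ ->]]]|t t0].
  exact/kerZ_table_ofP.
split=> [b|u v u0 v0 uv]; first exact: pad_orbit_kerZ.
have [s uE] := nonneg_table_of u0; have [s' vE] := nonneg_table_of v0.
rewrite {}uE {}vE {u v u0 v0} in uv *.
have rD i : (D + D <= r i)%N \/ t i = 0%N.
  by have [iT|/t0] := boolP (i \in T); [left; rewrite /r iT | right].
apply: connected_markov_path => //; apply: (same_marg_connected hm hT).
- by rewrite leq_max orbT.
- move=> a a' aa' a_gt0.
  have [|b [b' [bb' /andP[b_gt0 bD] ba ba']]] := D0P (widen_size r t) _ a a' aa' a_gt0.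
    move=> j jT; rewrite /widen_size /r (negPf jT) t0 // addn0.
    exact: leq_trans (leq_bigmax j) (leqnSn _).
  by exists b, b'; split=> //; rewrite b_gt0 (leq_trans bD) // leq_max leqnn.
exact/same_marg_sym/mulmxt_table_ofP.
Qed.
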